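(* Let $L$ be a proper sublattice of $\mathbb{Z}^2$. If $S=\mathbb{Z}^2\setminus L$, then $h(S)\leq 6$. This bound is sharp, i.e., there exists a proper sublattice $L$ of $\mathbb{Z}^2$ such that $h(\mathbb{Z}^2\setminus L)=6$.
   Context: A lattice in $\mathbb{R}^d$ is a discrete (additive) subgroup of $\mathbb{R}^d$; a sublattice of $\mathbb{Z}^2$ is a subgroup of $\mathbb{Z}^2$, and it is proper if it is different from $\mathbb{Z}^2$. For $S\subseteq\mathbb{R}^d$, the $S$-Helly number $h(S)$ is the smallest positive integer $h$ such that for every $m\in\mathbb{N}$ and all sets $F_1,\dots,F_m$ of the form $F_i=S\cap K_i$ with $K_i\subset\mathbb{R}^d$ convex, the following implication holds: if $F_{i_1}\cap\cdots\cap F_{i_h}\neq\emptyset$ for all $i_1,\dots,i_h\in\{1,\dots,m\}$, then $F_1\cap\cdots\cap F_m\neq\emptyset$. If no such $h$ exists, $h(S):=\infty$. *)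

(* Defs.v *)
From mathcomp Require Import all_boot all_order all_algebra.
From mathcomp Require Import all_classical all_reals all_analysis.

Set Implicit Arguments.
Unset Strict Implicit.
Unset Printing Implicit Defensive.

Import Order.TTheory GRing.Theory Num.Theory.

Local Open Scope classical_set_scope.
Local Open Scope ring_scope.

(* The intersection property of S for h-element subfamilies. The h indices
   f 0, ..., f (h-1) may repeat. Families are nonempty, 0 < m: a point lying in
   every member of the empty family is not required to lie in S. *)
Definition helly_property (R : realType) (d : nat) (S : set 'rV[R]_d)
    (h : nat) : Prop :=
  forall (m : nat) (K : 'I_m -> set 'rV[R]_d),
    (0 < m)%N -> (forall i, convex_set (K i)) ->
    (forall f : 'I_h -> 'I_m, \bigcap_(j in [set: 'I_h]) (S `&` K (f j)) !=set0) ->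
    \bigcap_(i in [set: 'I_m]) (S `&` K i) !=set0.

Definition is_helly_bound (R : realType) (d : nat) (S : set 'rV[R]_d)
    (h : nat) : bool :=
  (0 < h)%N && `[< helly_property S h >].

Definition helly_number (R : realType) (d : nat) (S : set 'rV[R]_d) : \bar R :=
  if pselect (exists h, is_helly_bound S h) is left ex_h
  then ((ex_minn ex_h)%:R%:E)%E else +oo%E.

Definition int_lattice (R : realType) (d : nat) : set 'rV[R]_d :=
  [set x | x \is a mxOver Num.int].
Arguments int_lattice : clear implicits.

Definition proper_sublattice (R : realType) (d : nat) (L : set 'rV[R]_d) : Prop :=
  [/\ L `<=` int_lattice R d, zmod_closed [in L] & L <> int_lattice R d].

(* Main.v *)
Require Import Defs.
From mathcomp Require Import all_boot all_order all_algebra.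
From mathcomp Require Import finmap.
From mathcomp Require Import all_classical all_reals all_analysis.
From mathcomp Require Import zify lra ring.

(** Why the theorem is true.

    Upper bound.  For a set S of lattice points, a failure of the Helly property
    for h-element subfamilies produces n > h points of S such that no point of S
    lies in all the hulls obtained by leaving out one of them (the argument that
    deduces Helly's theorem from Radon's, [helly_property_of_points]).  Trading a
    point of such a family for another point of S in its hull, in a well chosen
    way, shrinks the hull; as the hull contains finitely many lattice points, the
    process ends with n points of S that are in convex position and whose hull
    contains no further point of S ([empty_coreless_family]).  The trading only
    uses that hulls form an anti-exchange closure operator, so it is done for
    abstract finite closures ([closed_coreless_set]).

    Now let S be the complement in Z^d of a subgroup L: every lattice point of
    the hull other than the n vertices lies in L.  Compare parities of
    coordinates.  Two lattice points of equal parity have a lattice midpoint; if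
    they are distinct points of the hull and one of them is a vertex, then this
    midpoint is not a vertex, by convex position, so it is in L.  Hence no
    vertex x has the parity of a point y of L in the hull: otherwise
    x = 2 ((x + y) / 2) - y would be in L.  Nor do three vertices x, y, z have the
    same parity, because x = (x + y) / 2 + (x + z) / 2 - (y + z) / 2.  If two
    vertices share a parity, their midpoint is a point of L in the hull, so one of
    the 2^d parity classes contains no vertex and the others contain at most two:
    n <= 2 (2^d - 1) ([card_empty_free_family]).  For d = 2 this is 6.

    Sharpness.  For L = {0} the six points +-(1, 0), +-(0, 1), +-(1, 1) form a
    hexagon whose only other lattice point is 0.  The half-planes bounded by the
    lines through the two neighbours of a vertex each leave out exactly one of the
    six points, and 0 is the only lattice point common to all of them. *)

Set Implicit Arguments.
Unset Strict Implicit.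
Unset Printing Implicit Defensive.

Import Order.TTheory GRing.Theory Num.Theory.

(** * Finite anti-exchange closures *)

(** The closure operators of finite convex geometries in the sense of Edelman and
    Jamison.  The second clause combines monotonicity and idempotence. *)
Definition anti_exchange_closure (T : finType) (cl : {set T} -> {set T}) :=
  [/\ forall A : {set T}, A \subset cl A,
      forall A B : {set T}, A \subset cl B -> cl A \subset cl B
    & forall (B : {set T}) x y, x != y -> x \notin cl B ->
        y \in cl (x |: B) -> x \notin cl (y |: B)].

Definition helly_core (T : finType) (cl : {set T} -> {set T}) (A : {set T}) :
  {set T} := \bigcap_(a in A) cl (A :\ a).

(** If b were in the closure of the other points of A, it would belong to every
    closure in the intersection that defines the core. *)
Lemma notin_cl_coreless (T : finType) (cl : {set T} -> {set T})
    (A : {set T}) b :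
  anti_exchange_closure cl -> helly_core cl A = finset.set0 -> b \in A ->
  b \notin cl (A :\ b).
Proof.
move=> [subcl _ _] A0 bA; apply/negP => bcl.
suff: b \in helly_core cl A by rewrite A0 finset.in_set0.
apply/bigcapP => c cA; have [<-//|bc] := eqVneq b c.
by apply: (fintype.subsetP (subcl _)); rewrite !inE bc bA.
Qed.

Lemma notin_cl_exchange (T : finType) (cl : {set T} -> {set T})
    (A : {set T}) b t :
  anti_exchange_closure cl -> helly_core cl A = finset.set0 -> b \in A ->
  t \in cl A -> t != b -> b \notin cl (t |: A :\ b).
Proof.
move=> clP A0 bA tA tb; have [_ _ anti] := clP.
by apply: anti; rewrite 1?eq_sym ?finset.setD1K//; exact: notin_cl_coreless.
Qed.

(** The extraction step.  As long as cl A has a point s outside A, replace by s a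
    point a of A with s outside cl (A :\ a); then a leaves the closure, which
    becomes strictly smaller.  The core stays empty if s is chosen outside as few
    sets cl (A :\ b), with b in A, as possible: a point t of the new core would be
    outside some of the same sets only, and inside cl (A :\ a), against the choice
    of s. *)
Lemma closed_coreless_set (T : finType) (cl : {set T} -> {set T})
    (A : {set T}) :
  anti_exchange_closure cl -> helly_core cl A = finset.set0 ->
  exists B : {set T},
    [/\ #|B| = #|A|, cl B = B & helly_core cl B = finset.set0].
Proof.
move=> clP; have [subcl clmin _] := clP.
have clmono (B C : {set T}) : B \subset C -> cl B \subset cl C.
  by move=> BC; apply: clmin; exact: (fintype.subset_trans BC).
have [n] := ubnP #|cl A|; elim: n A => // n IH A; rewrite ltnS => len A0.
have [clA|] := boolP (cl A \subset A).
  by exists A; split=> //; apply/eqP; rewrite finset.eqEsubset clA subcl.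
case/fintype.subsetPn => x0 x0cl x0A.
pose bad s := [set a in A | s \notin cl (A :\ a)]%SET.
have x0P : x0 \in cl A :\: A by rewrite inE x0A.
case: (arg_minnP (fun s => #|bad s|) x0P).
move=> s /finset.setDP[scl sA] smin.
have [a] : exists a, a \in bad s.
  apply/finset.set0Pn/eqP => bads0.
  suff: s \in helly_core cl A by rewrite A0 finset.in_set0.
  apply/bigcapP => c cA; apply: contraT => sc.
  by have := finset.in_set0 c; rewrite -bads0 inE cA sc.
rewrite inE => /andP[aA sa].
have sneq b : b \in A -> s != b by apply: contraTneq => <-.
pose A' := s |: A :\ a.
have A'cl : cl A' \subset cl A.
  apply: clmin; rewrite finset.subUset finset.sub1set scl.
  exact: (fintype.subset_trans (finset.subsetDl _ _)).
have lt_cl : (#|cl A'| < #|cl A|)%N.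
  apply/proper_card/fintype.properP; split=> //.
  exists a; first exact: (fintype.subsetP (subcl A)).
  by apply: notin_cl_exchange; rewrite // sneq.
have A'0 : helly_core cl A' = finset.set0.
  apply/eqP/finset.set0Pn => -[t /bigcapP tcore].
  have ta : t \in cl (A :\ a).
    have := tcore s; rewrite finset.setU1K ?inE ?(negPf sA) ?andbF ?eqxx//.
    exact.
  have tb b : b \in A -> b != a -> t \in cl (s |: (A :\ a) :\ b).
    move=> bA ba; have := tcore b; rewrite !inE ba bA orbT => /(_ isT).
    apply: (fintype.subsetP (clmono _ _ _)); apply/fintype.subsetP => c.
    by rewrite !inE; case: (c == s); case: (c == b); rewrite ?andbF ?andbT.
  have tcl : t \in cl A.
    by apply: (fintype.subsetP (clmono _ _ _) _ ta); exact: subD1set.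
  have tA : t \notin A.
    apply/negP => tA; have ta' : t != a.
      by apply: contraTneq ta => ->; exact: notin_cl_coreless.
    have : t \notin cl (s |: A :\ t).
      by apply: notin_cl_exchange; rewrite // sneq.
    case/negP; apply: (fintype.subsetP (clmono _ _ _) _ (tb t tA ta')).
    by apply: finset.setUS; apply: finset.setSD; exact: subD1set.
  (* bad t is strictly contained in bad s: it misses a. *)
  have /smin : t \in cl A :\: A by rewrite inE tA.
  apply/negP; rewrite -ltnNge.
  apply: proper_card; apply/fintype.properP; split; last first.
    by exists a; rewrite inE ?aA ?sa// ta.
  apply/fintype.subsetP => c; rewrite !inE => /andP[cA tc].
  rewrite cA; apply: contra tc => sc.
  have ca : c != a by apply: contraNneq sa => <-.
  apply: (fintype.subsetP (clmin _ _ _) _ (tb c cA ca)).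
  rewrite finset.subUset finset.sub1set sc.
  apply: (fintype.subset_trans _ (subcl _)).
  by apply: finset.setSD; exact: subD1set.
have [B [cardB clB B0]] := IH A' (leq_trans lt_cl len) A'0.
exists B; split=> //; rewrite cardB cardsU1 !inE (negPf sA) andbF /=.
by rewrite (cardsD1 a A) aA.
Qed.

Local Open Scope classical_set_scope.
Local Open Scope ring_scope.

(** * Convex hulls *)

Lemma convex_setP (R : realType) (V : lmodType R) (A : set V) :
  convex_set A <->
  forall x y k, 0 <= k -> k <= 1 -> A x -> A y -> A (k *: x + (1 - k) *: y).
Proof.
split=> [cA x y k k0 k1 Ax Ay|cA x y k].
  by have := cA x y (Itv01 k0 k1); rewrite !inE; exact.
by rewrite !inE => Ax Ay; exact: cA.
Qed.

Definition hull (R : realType) (V : lmodType R) (A : set V) : set V :=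
  smallest (@convex_set R V) A.

Lemma convex_hull (R : realType) (V : lmodType R) (A : set V) :
  convex_set (hull A).
Proof.
apply/convex_setP => x y k k0 k1 hx hy K [cK AK].
by move/convex_setP: (cK); apply=> //; [exact: hx|exact: hy].
Qed.

Lemma hull_min (R : realType) (V : lmodType R) (A B : set V) :
  A `<=` hull B -> hull A `<=` hull B.
Proof. by move=> AB; apply: smallest_sub => //; exact: convex_hull. Qed.

Lemma hull_mono (R : realType) (V : lmodType R) (A B : set V) :
  A `<=` B -> hull A `<=` hull B.
Proof. by move=> AB; apply: hull_min; apply: sub_smallest. Qed.

(** The union of the segments from v to the points of C, without v itself when C
    does not contain it. *)
Definition punctured_cone (R : realType) (V : lmodType R) (v : V) (C : set V) :
  set V :=
  [set x | exists s c, [/\ 0 < s, s <= 1, C c & x = v + s *: (c - v)]].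

Lemma convex_punctured_cone (R : realType) (V : lmodType R) (v : V) (C : set V) :
  convex_set C -> convex_set (punctured_cone v C).
Proof.
move=> /convex_setP cC; apply/convex_setP => x y k k0 k1.
move=> [s [c [s0 s1 Cc ->]]] [s' [c' [s'0 s'1 Cc' ->]]].
pose r := k * s + (1 - k) * s'.
have r0 : 0 < r by rewrite /r; nra.
have comb w w' t :
    t *: w + (1 - t) *: w' - v = t *: (w - v) + (1 - t) *: (w' - v).
  by rewrite !scalerBr addrACA -opprD -scalerDl subrKC scale1r.
(* The new point is at the fraction r of the way from v to the point of C that
   divides the segment between c and c' in the ratio of k s to (1 - k) s'. *)
exists r, (k * s / r *: c + (1 - k * s / r) *: c'); split=> //.
- by rewrite /r; nra.
- apply: cC => //; first by rewrite divr_ge0// ?mulr_ge0// ltW.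
  by rewrite ler_pdivrMr// mul1r /r; nra.
rewrite comb (scalerDr r) (scalerDr k) (scalerDr (1 - k)) !scalerA addrACA.
rewrite -scalerDl subrKC scale1r.
by congr (_ + (_ *: _ + _ *: _)); rewrite /r; field; rewrite gt_eqF.
Qed.

(** Let N be the cone from x over the hull of B, without its apex x.  Both N and
    its union with x are convex, so y, which lies in the hull of B and x, is in N;
    then N contains the hull of B and y, but not x. *)
Lemma hull_anti_exchange (R : realType) (V : lmodType R) (B : set V) (x y : V) :
  x <> y -> ~ hull B x -> hull (x |` B) y -> ~ hull (y |` B) x.
Proof.
move=> xy xB yB; set N := punctured_cone x (hull B).
have xN : ~ N x.
  move=> [s [c [s0 _ Bc /eqP]]].
  rewrite addrC -subr_eq subrr eq_sym scaler_eq0 gt_eqF//= subr_eq0 => /eqP cx.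
  by apply: xB; rewrite -cx.
have BN : B `<=` N.
  move=> b Bb; exists 1, b; split=> //; first exact: sub_gen_smallest.
  by rewrite scale1r subrKC.
have cN : convex_set N by apply: convex_punctured_cone; exact: convex_hull.
have shrink z k : N z -> 0 < k -> k <= 1 -> N (k *: z + (1 - k) *: x).
  move=> [s [c [s0 s1 Bc ->]]] k0 k1; exists (k * s), c; split=> //.
  - exact: mulr_gt0.
  - by nra.
  - by rewrite scalerDr scalerA addrAC -scalerDl subrKC scale1r.
have cxN : convex_set (x |` N).
  apply/convex_setP => z w k k0 k1 [->|Nz] [->|Nw].
  - by left; rewrite -scalerDl subrKC scale1r.
  - move: k1; rewrite le_eqVlt => /predU1P[->|k1].
      by left; rewrite subrr scale0r addr0 scale1r.
    right; have := shrink w (1 - k) Nw; rewrite subKr [_ *: w + _]addrC.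
    by apply; lra.
  - move: k0; rewrite le_eqVlt => /predU1P[<-|k0].
      by left; rewrite subr0 scale0r add0r scale1r.
    by right; exact: shrink.
  - by right; move/convex_setP: cN; exact.
have /(_ y yB)[yx|Ny] : hull (x |` B) `<=` x |` N.
- by apply: smallest_sub => //; exact: setUS.
- by case: xy; rewrite yx.
move=> xyB; apply: xN; apply: (smallest_sub cN _ xyB).
by move=> z [->|/BN].
Qed.

(** * Empty families of lattice points *)

Lemma finite_lattice_hull (R : realType) (d n : nat) (p : 'I_n -> 'rV[R]_d) :
  finite_set (int_lattice R d `&` hull (range p)).
Proof.
pose M := \sum_i \sum_j `|p i 0 j|; pose N := Num.bound M.
pose box := [set x : 'rV[R]_d | forall j, `|x 0 j| <= N%:R].
have cbox : convex_set box.
  apply/convex_setP => x y k k0 k1 Bx By j; rewrite !mxE.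
  have := Bx j; have := By j; rewrite !ler_norml => /andP[? ?] /andP[? ?].
  by apply/andP; split; nra.
have pbox : range p `<=` box.
  move=> _ [i _ <-] j; apply/ltW/(le_lt_trans _ (archi_boundP _)).
    rewrite /M (bigD1 i)//= (bigD1 j)//= -addrA lerDl.
    by rewrite addr_ge0// sumr_ge0// => i' _; rewrite sumr_ge0.
  by rewrite sumr_ge0// => i' _; rewrite sumr_ge0.
pose f (x : 'rV['I_(N + N).+1]_d) : 'rV[R]_d := \row_j ((x 0 j)%:R - N%:R).
apply: (@sub_finite_set _ _ (range f)); last exact/finite_image/finite_finset.
move=> x [/mxOverP xZ /(smallest_sub cbox pbox) xB].
exists (\row_j inord `|(Num.floor (x 0 j) + N%:Z)%R|%N) => //.
apply/rowP => j; rewrite !mxE.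
have := xB j; have := xZ 0 j; rewrite intrEfloor => /eqP.
move: (Num.floor _) => z <-.
rewrite ler_norml -[N%:R]/(N%:~R) -mulrNz !ler_int => /andP[lo hi].
rewrite inordK; last by lia.
by rewrite pmulrn gez0_abs ?rmorphD/= ?addrK//; lia.
Qed.

(** The points of S in the hull of p form a finite set, on which the trace of
    the hull operator is an anti-exchange closure; [closed_coreless_set] then
    gives a family that is closed, meaning that its hull has no other point
    of S, and that is in convex position because its core is empty. *)
Lemma empty_coreless_family (R : realType) (d n : nat) (S : set 'rV[R]_d)
    (p : 'I_n -> 'rV[R]_d) :
  S `<=` int_lattice R d -> (forall i, S (p i)) ->
  (forall s, S s -> exists i, ~ hull (p @` [set~ i]) s) ->
  exists q : 'I_n -> 'rV[R]_d,
    [/\ injective q, forall i, S (q i),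
        forall i, ~ hull (q @` [set~ i]) (q i)
      & S `&` hull (range q) `<=` range q].
Proof.
move=> SZ Sp p0.
have pinj : injective p.
  move=> i j pij; apply/eqP; apply: contraT => /eqP ij.
  have [k] := p0 _ (Sp i); case; apply: sub_gen_smallest.
  have [ki|/eqP ki] := eqVneq i k; last by exists i.
  by exists j => //=; rewrite -ki => /esym.
have finX : finite_set (S `&` hull (range p)).
  apply: sub_finite_set (finite_lattice_hull p).
  by apply: setSI.
pose X := fset_set (S `&` hull (range p)); pose T : finType := Finite.clone X _.
have XP (t : T) : S (val t) /\ hull (range p) (val t).
  by have := valP t; rewrite in_fset_set// inE.
have pX i : p i \in X.
  rewrite in_fset_set// inE; split; first exact: Sp.
  by apply: sub_gen_smallest; exists i.
pose pT i : T := [` pX i]%fset.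
pose pts (B : {set T}) : set 'rV[R]_d := val @` [set` B].
pose cl (B : {set T}) : {set T} := [set t | `[< hull (pts B) (val t) >]]%SET.
have in_cl B t : t \in cl B <-> hull (pts B) (val t).
  by rewrite finset.in_set; split=> /asboolP.
have ptsU x B : pts (x |: B)%SET = val x |` pts B.
  apply/seteqP; split.
    by move=> _ [t /=/finset.setU1P[->|tB] <-]; [left|right; exists t].
  move=> _ [->|[t /= tB <-]].
    by exists x => //=; rewrite finset.setU11.
  by exists t => //=; rewrite finset.setU1r.
have clP : anti_exchange_closure cl.
  split=> [A|A B AB|B x y xy xB yB].
  - apply/fintype.subsetP => t tA; apply/in_cl.
    by apply: sub_gen_smallest; exists t.
  - apply/fintype.subsetP => t /in_cl tA; apply/in_cl; apply: hull_min tA.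
    by move=> _ [u /= uA <-]; apply/in_cl; exact: (fintype.subsetP AB).
  - apply/negP => /in_cl; rewrite ptsU; apply: hull_anti_exchange.
    + by move=> /val_inj /eqP; apply/negP.
    + by move/in_cl; exact/negP.
    + by move/in_cl: yB; rewrite ptsU.
pose A := (pT @: finset.setT)%SET.
have A0 : helly_core cl A = finset.set0.
  apply/eqP/finset.set0Pn => -[t /bigcapP tcore].
  have [i] := p0 _ (XP t).1; apply.
  have /in_cl : t \in cl (A :\ pT i) by apply: tcore; exact: imset_f.
  apply: hull_mono => _ [u /= /setD1P[ui /imsetP[j _ uj]] <-].
  by exists j; rewrite ?uj// => ij; case/eqP: ui; rewrite uj ij.
have cardA : #|A| = n.
  rewrite card_imset ?cardsT ?card_ord// => i j /(congr1 val) /=.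
  exact: pinj.
have [B [cardB clB B0]] := closed_coreless_set clP A0.
rewrite cardA in cardB.
pose q i := val (enum_val (cast_ord (esym cardB) i)).
have rangeq : range q = pts B.
  apply/seteqP; split=> [_ [i _ <-]|_ [t /= tB <-]].
    by exists (enum_val (cast_ord (esym cardB) i)) => //=; exact: enum_valP.
  exists (cast_ord cardB (enum_rank_in tB t)) => //.
  by rewrite /q cast_ordK enum_rankK_in.
have qinj : injective q.
  by move=> i j /val_inj /enum_val_inj /cast_ord_inj.
exists q; split=> //.
- by move=> i; exact: (XP _).1.
- move=> i qi.
  have bB := enum_valP (cast_ord (esym cardB) i).
  have /negP := notin_cl_coreless clP B0 bB; apply; apply/in_cl.
  apply: hull_mono qi => _ [j /= ji <-].
  exists (enum_val (cast_ord (esym cardB) j)) => //=.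
  apply/setD1P; split; last exact: enum_valP.
  by apply/eqP => /enum_val_inj /cast_ord_inj.
- rewrite rangeq => x [Sx hx].
  have xX : x \in X.
    rewrite in_fset_set// inE; split=> //; apply: hull_min hx.
    by move=> _ [t _ <-]; exact: (XP t).2.
  exists [` xX]%fset => //=.
  by rewrite -clB; apply/in_cl.
Qed.

(** * From points to the Helly property *)

(** If all subfamilies of k >= h members meet in S, so do all those of k + 1
    members: pick in S a point p i common to all members but the i-th.  The point
    s provided by the hypothesis for p lies in each member, since the member of
    index j contains all p i with i <> j. *)
Lemma helly_property_of_points (R : realType) (d : nat) (S : set 'rV[R]_d)
    (h : nat) :
  (0 < h)%N ->
  (forall n (p : 'I_n -> 'rV[R]_d), (h < n)%N -> (forall i, S (p i)) ->
     exists2 s, S s & forall i, hull (p @` [set~ i]) s) ->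
  helly_property S h.
Proof.
move=> h0 core m K m0 cK Kh.
have Kk k : forall f : 'I_(h + k) -> 'I_m,
    \bigcap_(j in [set: 'I_(h + k)]) (S `&` K (f j)) !=set0.
  elim: k => [|k IH]; first by rewrite addn0.
  rewrite addnS => f.
  have /choice[p pP] : forall i, exists x, S x /\ forall j, K (f (lift i j)) x.
    move=> i; have [x xP] := IH (f \o lift i); exists x; split.
      by have [] := xP (Ordinal (ltn_addr k h0)) I.
    by move=> j; have [] := xP j I.
  have [s Ss sP] :=
    core _ p (leq_addr k h : (h < (h + k).+1)%N) (fun i => (pP i).1).
  exists s => j _; split=> //.
  apply: (smallest_sub (cK (f j)) _ (sP j)) => _ [i /= ij <-].
  have [j' ->] : exists j', j = lift i j'.
    by case: (unliftP i j) => [j' ->|/esym /ij//]; exists j'.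
  exact: (pP i).2.
(* Indices may repeat, so a surjection from 'I_(h + m) reaches the whole family,
   also when m < h. *)
have [g gP] : exists g : 'I_(h + m) -> 'I_m, forall i, exists j, g j = i.
  exists (fun j => odflt (Ordinal m0) (insub (j : nat))) => i.
  by exists (widen_ord (leq_addl h m) i); rewrite /= valK.
have [x xP] := Kk m g; exists x => i _.
by have [j <-] := gP i; exact: xP.
Qed.

(** * Parities in the complement of a sublattice *)

(** The class modulo 2 of a lattice point; the floor only serves to read off the
    integer behind a real coordinate. *)
Definition parity (R : realType) (d : nat) (x : 'rV[R]_d) :
  {ffun 'I_d -> bool} :=
  [ffun j => odd `|Num.floor (x 0 j)|].

Definition midpoint (R : realType) (V : lmodType R) (x y : V) : V :=
  2^-1 *: x + 2^-1 *: y.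

Lemma midpointD (R : realType) (V : lmodType R) (x y : V) :
  midpoint x y + midpoint x y = x + y.
Proof.
rewrite /midpoint -scalerDr -scalerDl (_ : 2^-1 + 2^-1 = 1) ?scale1r//.
by field.
Qed.

Lemma hull_midpoint (R : realType) (V : lmodType R) (A : set V) (x y : V) :
  hull A x -> hull A y -> hull A (midpoint x y).
Proof.
move=> Ax Ay; have /convex_setP/(_ x y 2^-1) := @convex_hull R V A.
rewrite (_ : 1 - 2^-1 = 2^-1); last by field.
by apply=> //; lra.
Qed.

Lemma midpoint_int_lattice (R : realType) (d : nat) (x y : 'rV[R]_d) :
  int_lattice R d x -> int_lattice R d y -> parity x = parity y ->
  int_lattice R d (midpoint x y).
Proof.
move=> /mxOverP xZ /mxOverP yZ xy; apply/mxOverP => i j.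
rewrite [i]ord1 !mxE; have := congr1 (fun f : {ffun 'I_d -> bool} => f j) xy.
rewrite /parity !ffunE.
have := xZ 0 j; have := yZ 0 j; rewrite !intrEfloor => /eqP + /eqP.
move: (Num.floor _) (Num.floor _) => m n <- <- mn.
have -> : 2^-1 * m%:~R + 2^-1 * n%:~R = ((m + n) %/ 2)%Z%:~R :> R.
  have : m + n = ((m + n) %/ 2)%Z * 2 by lia.
  move: ((m + n) %/ 2)%Z => k e; rewrite -mulrDr -rmorphD/= e rmorphM/=; by field.
by rewrite -intrEfloor; exact: intr_int.
Qed.

Lemma card_le_double_fibers (I C : finType) (f : I -> C) (c0 : C) :
  (forall i, f i != c0) -> (forall c, #|[pred i | f i == c]| <= 2)%N ->
  (#|I| <= 2 * #|C|.-1)%N.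
Proof.
move=> fc0 f2; rewrite -sum1_card (partition_big f predT)//= (bigD1 c0)//=.
rewrite big_pred0; last by move=> i; exact/negbTE.
rewrite add0n.
have -> : (2 * #|C|.-1 = \sum_(c | c != c0) 2)%N.
  by rewrite sum_nat_const cardC1 mulnC.
by apply: leq_sum => c _; rewrite sum1_card; exact: f2.
Qed.

(** A vertex p k which is the midpoint of p i and y would be in the hull of y and
    the vertices other than p k, which anti-exchange forbids. *)
Lemma midpoint_notin_free (R : realType) (V : lmodType R) (n : nat)
    (p : 'I_n -> V) i y :
  injective p -> (forall k, ~ hull (p @` [set~ k]) (p k)) ->
  hull (range p) y -> y <> p i -> ~ range p (midpoint (p i) y).
Proof.
move=> pinj pfree py yi [k _ kE].
have kk := midpointD (p i) y; rewrite -kE in kk.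
have ky : p k <> y.
  by move=> ky; apply: yi; move: kk; rewrite ky => /addIr.
have ki : i <> k.
  by move=> ik; apply: ky; move: kk; rewrite ik => /addrI.
apply: (hull_anti_exchange ky (pfree k)).
  apply: hull_mono py => _ [j _ <-].
  by have [->|/eqP jk] := eqVneq j k; [left|right; exists j].
rewrite [X in hull _ X]kE; apply: hull_midpoint; apply: sub_gen_smallest.
  by right; exists i.
by left.
Qed.

(** Each parity class contains at most two vertices, and the class of a point of L
    in the hull contains none.  Such a point is provided by the midpoint of two
    vertices of equal parity; if there are no such vertices then n <= 2 ^ d, which
    is good enough because d > 0. *)
Lemma card_empty_free_family (R : realType) (d n : nat) (L : set 'rV[R]_d)
    (p : 'I_n -> 'rV[R]_d) :
  (0 < d)%N -> proper_sublattice L -> injective p ->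
  (forall i, (int_lattice R d `\` L) (p i)) ->
  (forall i, ~ hull (p @` [set~ i]) (p i)) ->
  (int_lattice R d `\` L) `&` hull (range p) `<=` range p ->
  (n <= 2 * (2 ^ d).-1)%N.
Proof.
move=> d0 [LZ [_ LB] _] pinj pS pfree pempty.
have {}LB x y : L x -> L y -> L (x - y).
  by move=> Lx Ly; have := LB x y; rewrite !inE; exact.
have LD x y : L x -> L y -> L (x + y).
  move=> Lx Ly; rewrite -[y]opprK; apply: (LB) => //.
  by rewrite -[- y]add0r -(subrr y); apply: (LB) => //; apply: (LB).
have php i : hull (range p) (p i) by apply: sub_gen_smallest; exists i.
have midL i y : int_lattice R d y -> hull (range p) y -> y <> p i ->
    parity (p i) = parity y -> L (midpoint (p i) y).
  move=> yZ yp yi piy; apply: contrapT => mL.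
  apply: (midpoint_notin_free pinj pfree yp yi); apply: pempty; split.
    by split=> //; apply: midpoint_int_lattice => //; exact: (pS i).1.
  exact: hull_midpoint.
have midpp i j : i != j -> parity (p i) = parity (p j) ->
    L (midpoint (p i) (p j)).
  move=> ij; apply: midL => //; first exact: (pS j).1.
  by move=> /pinj /eqP; rewrite eq_sym; apply/negP.
have LC x y : L (x + y) -> L y -> L x.
  by move=> Lxy Ly; rewrite -[x](addrK y); apply: (LB).
have Lparity y i : L y -> hull (range p) y -> parity (p i) != parity y.
  move=> Ly yp; apply/eqP => iy; apply: (pS i).2.
  apply: (LC _ y) => //; rewrite -midpointD.
  have yi : y <> p i by move=> yi; apply: (pS i).2; rewrite -yi.
  by apply: (LD); apply: midL => //; exact: LZ.
have fib2 c : (#|[pred i | parity (p i) == c]| <= 2)%N.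
  rewrite leqNgt; apply/card_gt2P => -[i [j [k [[]]]]].
  rewrite !inE => /eqP ic /eqP jc /eqP kc [ij jk ki].
  apply: (pS i).2.
  have -> : p i = midpoint (p i) (p j) + midpoint (p k) (p i)
                  - midpoint (p j) (p k).
    by apply/rowP => r; rewrite !mxE; field.
  by apply: (LB); [apply: (LD)|]; apply: midpp; rewrite ?ic ?jc ?kc.
have card_parity : #|{ffun 'I_d -> bool}| = (2 ^ d)%N.
  by rewrite card_ffun card_bool card_ord.
have [pi|] := boolP (injectiveb (fun i => @parity R d (p i))).
  have := leq_card _ (injectiveP _ pi); rewrite card_ord card_parity.
  move/leq_trans; apply; rewrite mul2n -addnn.
  have : (2 <= 2 ^ d)%N by rewrite -[X in (X <= _)%N]expn1 leq_exp2l.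
  by move: (2 ^ d)%N => N; lia.
case/injectivePn => i [j ij ijp].
rewrite -card_parity -[n]card_ord.
apply: (card_le_double_fibers (f := fun i => parity (p i))
          (c0 := parity (midpoint (p i) (p j)))) => // k.
by apply: Lparity; [exact: midpp|exact: hull_midpoint].
Qed.

Lemma helly_property_diff_sublattice (R : realType) (d : nat)
    (L : set 'rV[R]_d) :
  (0 < d)%N -> proper_sublattice L ->
  helly_property (int_lattice R d `\` L) (2 * (2 ^ d).-1).
Proof.
move=> d0 LP; apply: helly_property_of_points.
  rewrite muln_gt0 -subn1 subn_gt0 /=.
  by rewrite -[X in (X < _)%N](expn0 2) ltn_exp2l.
move=> n p ltn pS; apply: contrapT => nos.
have pcore s : (int_lattice R d `\` L) s ->
    exists i, ~ hull (p @` [set~ i]) s.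
  by move=> sS; apply/existsNP => allp; apply: nos; exists s.
have [q [qinj qS qfree qempty]] :=
  empty_coreless_family (@subDsetl _ _ _) pS pcore.
have := card_empty_free_family d0 LP qinj qS qfree qempty.
by rewrite leqNgt ltn.
Qed.

(** * Bounds on Helly numbers *)

Lemma helly_number_le (R : realType) (d : nat) (S : set 'rV[R]_d) (h : nat) :
  (0 < h)%N -> helly_property S h -> (helly_number S <= h%:R%:E)%E.
Proof.
move=> h0 Sh; have hb : is_helly_bound S h.
  by rewrite /is_helly_bound h0; apply/asboolP.
rewrite /helly_number; case: pselect => [ex_h|]; last by case; exists h.
by rewrite lee_fin ler_nat; case: ex_minnP => m _; exact.
Qed.

Lemma helly_number_ge (R : realType) (d : nat) (S : set 'rV[R]_d) (h : nat) :
  (forall k, helly_property S k -> (h <= k)%N) ->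
  (h%:R%:E <= helly_number S)%E.
Proof.
move=> Sh; rewrite /helly_number; case: pselect => [ex_h|]; last by rewrite leey.
rewrite lee_fin ler_nat; case: ex_minnP => m /andP[_ /asboolP Sm] _.
exact: Sh.
Qed.

(** * The hexagon around the origin *)

(** Listed in cyclic order. *)
Definition hexagon_vertex (R : realType) (i : 'I_6) : 'rV[R]_2 :=
  let z := nth (0, 0) [:: (1, 0); (1, 1); (0, 1);
                          (-1, 0); (-1, -1); (0, -1)] i in
  \row_j (if j == 0 then z.1 else z.2).

(** The half-plane, on the side of the origin, of the line through the two
    neighbours of the i-th vertex. *)
Definition hexagon_cut (R : realType) (i : 'I_6) : set 'rV[R]_2 :=
  let u := nth (0, 0) [:: (2, -1); (1, 1); (-1, 2);
                          (-2, 1); (-1, -1); (1, -2)] i in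
  [set x | u.1 * x 0 0 + u.2 * x 0 1 <= 1].

Lemma convex_hexagon_cut (R : realType) (i : 'I_6) :
  convex_set (@hexagon_cut R i).
Proof.
apply/convex_setP => x y k k0 k1; rewrite /hexagon_cut /= !mxE.
case: (nth _ _ _) => a b /= hx hy; nra.
Qed.

Lemma hexagon_vertex_cut (R : realType) (i j : 'I_6) :
  i != j -> hexagon_cut j (hexagon_vertex R i).
Proof.
rewrite /hexagon_cut /hexagon_vertex /= !mxE /=.
case: i => [[|[|[|[|[|[|//]]]]]] ?];
  case: j => [[|[|[|[|[|[|//]]]]]] ?] //= _; lra.
Qed.

(** The cuts say that |x + y|, |2x - y| and |2y - x| are at most 1.  Adding the
    first two gives |3x| <= 2, and adding the first and the last |3y| <= 2. *)
Lemma hexagon_cuts_lattice0 (R : realType) (x : 'rV[R]_2) :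
  int_lattice R 2 x -> (forall i, hexagon_cut i x) -> x = 0.
Proof.
move=> /mxOverP xZ xcut.
have [/intrP[m xm] /intrP[n xn]] := (xZ 0 0, xZ 0 1).
have cut i (ilt : (i < 6)%N) := xcut (Ordinal ilt).
have := cut 0%N isT; have := cut 1%N isT; have := cut 2%N isT.
have := cut 3%N isT; have := cut 4%N isT; have := cut 5%N isT.
rewrite /hexagon_cut /= xm xn => h5 h4 h3 h2 h1 h0.
have m0 : m = 0.
  have : -1 < m%:~R :> R by lra.
  have : m%:~R < 1 :> R by lra.
  rewrite -[-1]/((-1)%:~R) -[1]/(1%:~R) !ltr_int; lia.
have n0 : n = 0.
  have : -1 < n%:~R :> R by lra.
  have : n%:~R < 1 :> R by lra.
  rewrite -[-1]/((-1)%:~R) -[1]/(1%:~R) !ltr_int; lia.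
apply/rowP => j; rewrite mxE; case: j => [[|[|//]] jlt].
  by rewrite (_ : Ordinal jlt = 0) ?xm ?m0//; exact: val_inj.
by rewrite (_ : Ordinal jlt = 1) ?xn ?n0//; exact: val_inj.
Qed.

Lemma hexagon_vertex_int (R : realType) (i : 'I_6) :
  (int_lattice R 2 `\` [set 0]) (hexagon_vertex R i).
Proof.
split.
  apply/mxOverP => r j; rewrite mxE.
  case: i => [[|[|[|[|[|[|//]]]]]] ?] /=; case: ifP => _;
    by rewrite ?rpredN ?rpred0 ?rpred1.
move=> /matrixP z0; have := z0 0 0; have := z0 0 1; rewrite {z0} !mxE /=.
by case: i => [[|[|[|[|[|[|//]]]]]] ?] /=; lra.
Qed.

(** Fewer than six cuts leave out some index i, and then share the i-th vertex. *)
Lemma hexagon_helly_property_ge (R : realType) (h : nat) :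
  helly_property (int_lattice R 2 `\` [set 0]) h -> (6 <= h)%N.
Proof.
move=> Sh; rewrite leqNgt; apply/negP => lth.
have [f|x xcut] := Sh 6%N (@hexagon_cut R) isT (@convex_hexagon_cut R).
  have [i fi] : exists i, i \notin (f @: finset.setT)%SET.
    have : (#|(f @: finset.setT)%SET| < #|'I_6|)%N.
      by rewrite (leq_ltn_trans (leq_imset_card _ _))// cardsT !card_ord.
    rewrite ltnNge => /negP fsmall; apply: contrapT => /forallNP fall.
    apply: fsmall; apply: subset_leq_card; apply/fintype.subsetP => i _.
    by apply/negPn/negP; exact: fall.
  exists (hexagon_vertex R i) => j _; split; first exact: hexagon_vertex_int.
  by apply: hexagon_vertex_cut; apply: contraNneq fi => ->; exact: imset_f.
have [[xZ x0] _] := xcut ord0 I; apply: x0.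
by apply: hexagon_cuts_lattice0 => // i; have [] := xcut i I.
Qed.

Lemma proper_sublattice0 (R : realType) : proper_sublattice [set (0 : 'rV[R]_2)].
Proof.
split.
- by move=> _ ->; apply/mxOverP => i j; rewrite mxE.
- by split=> [|x y]; rewrite !inE// => -> ->; rewrite subr0.
- move=> L0; have [] := hexagon_vertex_int R ord0.
  by rewrite -L0.
Qed.

(** * Helly numbers of complements of sublattices of the plane *)

Theorem theorem1p2 (R : realType) :
  (forall L : set 'rV[R]_2, proper_sublattice L ->
     (helly_number (int_lattice R 2 `\` L) <= 6%:R%:E)%E) /\
  (exists L : set 'rV[R]_2, proper_sublattice L /\
     helly_number (int_lattice R 2 `\` L) = (6%:R%:E)%E).
Proof.
have le6 (L : set 'rV[R]_2) : proper_sublattice L ->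
    (helly_number (int_lattice R 2 `\` L) <= 6%:R%:E)%E.
  move=> LP; apply: helly_number_le => //.
  exact: (helly_property_diff_sublattice (d := 2)).
split=> //; exists [set 0]; split; first exact: proper_sublattice0.
apply/eqP; rewrite eq_le le6 ?helly_number_ge//; last exact: proper_sublattice0.
exact: hexagon_helly_property_ge.
Qed.
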